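(* Let $n\ge 1$ and $t\ge 1$ be integers and let $D\subseteq S_n$ be a nonempty $t$-design in the metric space $(S_n,d_S)$. Then $|D|\ge n(n-1)\cdots(n-t+1)$. Moreover, if equality holds, then the frequencies of $D$ satisfy $f_i=0$ for all $i\in\{1,2,\dots,n-t\}$.
   Context: $S_n$ is the symmetric group on $n$ letters. For $\nu\in S_n$ let $F(\nu)$ be its number of fixed points. The metric is $d_S(\sigma,\theta)=n-F(\sigma\theta^{-1})$, taking values in $\{0,1,\dots,n\}$. For $j\in\{0,\dots,n\}$ let $v_j$ be the number of permutations in $S_n$ having exactly $n-j$ fixed points (i.e. at distance $j$ from the identity). For a nonempty $D\subseteq S_n$, its frequencies are $f_i=\frac{|\{(x,y)\in D^2: d_S(x,y)=i\}|}{|D|^2}$ for $i\in\{0,\dots,n\}$. $D$ is a $t$-design if $\sum_{j=0}^n f_j j^i=\sum_{j=0}^n \frac{v_j}{n!} j^i$ for every $i=1,\dots,t$. *)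

(* Defs.v *)
From mathcomp Require Import all_boot all_order all_fingroup all_algebra.

Set Implicit Arguments.
Unset Strict Implicit.
Unset Printing Implicit Defensive.

Import GRing.Theory.
Local Open Scope ring_scope.

Definition nfix (n : nat) (s : 'S_n) : nat := #|[set x : 'I_n | s x == x]|.

(* mathcomp composes permutations left to right, (s * t) x = t (s x); this is
   harmless here, as s * t^-1 and t^-1 * s are conjugate. *)
Definition dS (n : nat) (s t : 'S_n) : nat := (n - nfix (s * t^-1)%g)%N.

Definition nperm_dist (n : nat) (j : nat) : nat :=
  #|[set s : 'S_n | nfix s == (n - j)%N]|.

Definition freq (n : nat) (D : {set 'S_n}) (i : nat) : rat :=
  #|[set p in setX D D | dS p.1 p.2 == i]|%:R / (#|D| ^ 2)%N%:R.

Definition is_design (n : nat) (t : nat) (D : {set 'S_n}) : Prop :=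
  forall i : nat, (1 <= i <= t)%N ->
    \sum_(j < n.+1) freq D j * (j%:R) ^+ i
      = \sum_(j < n.+1) (nperm_dist n j)%:R / (n`!)%:R * (j%:R) ^+ i.

(* Main.v *)
Require Import Defs.
From mathcomp Require Import all_boot all_order all_fingroup all_algebra.

(** The falling factorial F(F-1)...(F-t+1) of the number F of fixed points is a
    polynomial of degree t in the distance n - F, so a t-design gives it the same
    average over D x D as over S_n, and the latter average is 1 when t <= n.
    The |D| diagonal pairs each contribute n(n-1)...(n-t+1) to a sum of
    nonnegative terms equal to |D|^2, which is the bound.  In case of equality
    every off-diagonal term vanishes: distinct elements of D agree in fewer
    than t points, that is, are at distance more than n - t. *)

Set Implicit Arguments.
Unset Strict Implicit.
Unset Printing Implicit Defensive.

Import GRing.Theory Num.Theory.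
Local Open Scope ring_scope.

Lemma sum_card_fiber (T : finType) (A : {set T}) (d : T -> nat) (m : nat)
    (g : nat -> rat) :
  {in A, forall p, (d p < m)%N} ->
  \sum_(j < m) #|[set p in A | d p == j]|%:R * g j = \sum_(p in A) g (d p).
Proof.
move=> dm; have [->|[p0 p0A]] := set_0Vmem A.
  rewrite [RHS]big_set0 big1 // => j _.
  by rewrite (_ : [set _ in _ | _] = set0) ?cards0 ?mul0r //; apply/setP => x; rewrite !inE.
case: m dm => [/(_ _ p0A)//|m dm].
rewrite [RHS](partition_big (fun p => inord (d p) : 'I_m.+1) predT) //=.
apply: eq_bigr => j _.
rewrite (eq_bigl [in [set p in A | d p == j]]); last first.
  move=> p; rewrite !inE; case pA: (p \in A) => //=.
  by rewrite -val_eqE /= inordK // dm.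
rewrite (eq_bigr (fun=> g j)); last by move=> p; rewrite inE => /andP[_ /eqP->].
by rewrite sumr_const mulr_natl.
Qed.

Lemma eq_moments_horner (m t : nat) (w1 w2 : 'I_m -> rat) (p : {poly rat}) :
  (size p <= t.+1)%N ->
  (forall i, (i <= t)%N ->
     \sum_j w1 j * j%:R ^+ i = \sum_j w2 j * j%:R ^+ i) ->
  \sum_j w1 j * p.[j%:R] = \sum_j w2 j * p.[j%:R].
Proof.
move=> sp hw.
have E (w : 'I_m -> rat) : \sum_j w j * p.[j%:R]
    = \sum_(i < t.+1) p`_i * \sum_j w j * j%:R ^+ i.
  under eq_bigr do rewrite (horner_coef_wide _ sp) mulr_sumr.
  rewrite exchange_big; apply: eq_bigr => i _; rewrite mulr_sumr.
  by apply: eq_bigr => j _; rewrite mulrCA.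
by rewrite !E; apply: eq_bigr => i _; rewrite hw // -ltnS.
Qed.

(** Signed differences in the rationals cause no discrepancy: when [k < t], the factor with [i = k]
    kills the product, and [k ^_ t] is zero as well. *)
Lemma natr_ffact (k t : nat) :
  ((k ^_ t)%:R : rat) = \prod_(i < t) (k%:R - i%:R).
Proof.
elim: t => [|t IH]; first by rewrite big_ord0.
rewrite big_ord_recr /= -IH ffactnSr natrM.
by case: (leqP t k) => tk; [rewrite natrB | rewrite ffact_small // !mul0r].
Qed.

(** The family [s] is arbitrary so that the same regrouping by distance serves both the quotients of
    pairs from a design and the whole symmetric group. *)
Lemma sum_fiber_nfix (n t : nat) (T : finType) (A : {set T}) (s : T -> 'S_n) :
  \sum_(j < n.+1) #|[set p in A | (n - nfix (s p))%N == j]|%:R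
      * (((n - j) ^_ t)%:R : rat)
  = \sum_(p in A) (nfix (s p) ^_ t)%:R.
Proof.
rewrite (sum_card_fiber (fun j => ((n - j) ^_ t)%:R)); last first.
  by move=> p _; rewrite ltnS leq_subr.
by apply: eq_bigr => p _; rewrite subKn // -[leqRHS]card_ord max_card.
Qed.

(** Fixing [B] pointwise means moving only points of its complement, so these are the permutations
    of [~: B]. *)
Lemma card_pointwise_stab (n : nat) (B : {set 'I_n}) :
  #|[set s : 'S_n | B \subset [set x | s x == x]]| = (n - #|B|)`!.
Proof.
have <- : #|~: B| = (n - #|B|)%N by rewrite cardsCs setCK card_ord.
rewrite -card_perm; apply: eq_card => s; rewrite !inE.
apply/subsetP/subsetP => [h x|h x xB].
  by rewrite !inE; apply: contra => /h; rewrite inE.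
by rewrite inE; apply/negPn/negP => /h; rewrite inE xB.
Qed.

(** Double counting: [nfix s ^_ t] is [t]! times the number of [t]-subsets fixed pointwise by [s].
    Exchanging the sums, each of the ['C(n, t)] subsets is fixed by [(n - t)]! permutations. *)
Lemma sum_nfix_ffact (n t : nat) : (t <= n)%N ->
  (\sum_(s : 'S_n) nfix s ^_ t)%N = n`!.
Proof.
move=> tn; under eq_bigr => s _.
  rewrite -bin_ffact -cards_draws -sum1_card.
  rewrite (eq_bigl (fun B : {set 'I_n} =>
    (#|B| == t) && (B \subset [set x | s x == x]))); last first.
    by move=> B; rewrite inE andbC.
  over.
rewrite -big_distrl /= (exchange_big_dep (fun B : {set 'I_n} => #|B| == t)) /=;
  last by move=> s B _ /andP[].
under eq_bigr => B /eqP Bt.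
  rewrite (eq_bigl [in [set s : 'S_n | B \subset [set x | s x == x]]]);
    last by move=> s; rewrite inE Bt eqxx.
  rewrite sum1_card card_pointwise_stab Bt; over.
rewrite sum_nat_const; have := card_draws 'I_n t; rewrite cardsE card_ord => ->.
by rewrite -mulnA [X in (_ * X)%N]mulnC bin_fact.
Qed.

Lemma nperm_dist_fiber (n : nat) (j : 'I_n.+1) :
  nperm_dist n j = #|[set s in [set: 'S_n] | (n - nfix s)%N == j]|.
Proof.
apply: eq_card => s; rewrite !inE.
have sn : (nfix s <= n)%N by rewrite -[leqRHS]card_ord max_card.
have jn : (j <= n)%N by rewrite -ltnS.
by apply/eqP/eqP => [->|<-]; rewrite subKn.
Qed.

Lemma design_sum_ffact (n t : nat) (D : {set 'S_n}) :
  (t <= n)%N -> D != set0 -> is_design t D ->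
  (\sum_(p in setX D D) nfix (p.1 * p.2^-1)%g ^_ t = #|D| ^ 2)%N.
Proof.
move=> tn D0 hD.
have D2 : ((#|D| ^ 2)%N%:R : rat) != 0.
  by rewrite pnatr_eq0 expn_eq0 cards_eq0 negb_and D0.
have nf : (n`!%:R : rat) != 0 by rewrite pnatr_eq0 -lt0n fact_gt0.
pose s2 (p : 'S_n * 'S_n) := (p.1 * p.2^-1)%g.
(* The order [u] stays free here and in [perm_sum]: [u = 0] gives the total mass, [u = t] the wanted
   identity. *)
have freq_sum u : \sum_(j < n.+1) freq D j * ((n - j) ^_ u)%:R
    = (\sum_(p in setX D D) nfix (s2 p) ^_ u)%N%:R / (#|D| ^ 2)%N%:R.
  rewrite natr_sum -(sum_fiber_nfix u (setX D D) s2) mulr_suml.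
  by apply: eq_bigr => j _; rewrite /freq mulrAC.
have perm_sum u : (u <= n)%N ->
    \sum_(j < n.+1) (nperm_dist n j)%:R / n`!%:R * ((n - j) ^_ u)%:R = 1 :> rat.
  move=> un.
  transitivity ((\sum_(s : 'S_n) nfix s ^_ u)%N%:R / n`!%:R : rat); last first.
    by rewrite sum_nfix_ffact // divff.
  rewrite natr_sum.
  rewrite (eq_bigl [in [set: 'S_n]]); last by move=> s; rewrite inE.
  rewrite -(sum_fiber_nfix u [set: 'S_n] id) mulr_suml.
  by apply: eq_bigr => j _; rewrite mulrAC nperm_dist_fiber.
(* A design constrains only the exponents from 1 on, but [q] below may have a constant term; at
   exponent 0 both sides are total masses, equal to 1. *)
have moment0 : \sum_(j < n.+1) freq D j * j%:R ^+ 0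
    = \sum_(j < n.+1) (nperm_dist n j)%:R / n`!%:R * j%:R ^+ 0.
  transitivity (1 : rat); last exact: esym (perm_sum 0%N isT).
  apply: etrans (freq_sum 0%N) _; rewrite (eq_bigr (fun=> 1%N)) //.
  by rewrite sum1_card cardsX mulnn divff.
pose q : {poly rat} := \prod_(i < t) (n%:R%:P - i%:R%:P - 'X).
have sq : (size q <= t.+1)%N.
  rewrite /q; elim: (t) => [|u IH]; first by rewrite big_ord0 size_poly1.
  rewrite big_ord_recr /= -polyCB; apply: leq_trans (size_polyMleq _ _) _.
  rewrite -opprB size_polyN size_XsubC addn2 /=; exact: IH.
have qE (j : 'I_n.+1) : q.[j%:R] = ((n - j) ^_ t)%:R.
  rewrite horner_prod natr_ffact; apply: eq_bigr => i _.
  by rewrite !hornerE natrB -1?ltnS // addrAC.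
have moments i : (i <= t)%N -> \sum_(j < n.+1) freq D j * j%:R ^+ i
    = \sum_(j < n.+1) (nperm_dist n j)%:R / n`!%:R * j%:R ^+ i.
  by case: i => [|i] it; [exact: moment0 | exact: hD].
have := eq_moments_horner sq moments.
rewrite (eq_bigr (fun j : 'I_n.+1 => freq D j * ((n - j) ^_ t)%:R)); last first.
  by move=> j _; rewrite qE.
rewrite freq_sum [RHS](eq_bigr (fun j : 'I_n.+1 =>
  (nperm_dist n j)%:R / n`!%:R * ((n - j) ^_ t)%:R)); last by move=> j _; rewrite qE.
rewrite perm_sum // => /(canRL (divfK D2)).
by rewrite mul1r => /eqP; rewrite eqr_nat => /eqP.
Qed.

Theorem theorem6 (n t : nat) (hn : (1 <= n)%N) (ht : (1 <= t)%N)
    (D : {set 'S_n}) (hD0 : D != set0) (hD : is_design t D) :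
  (n ^_ t <= #|D|)%N /\
  (#|D| = (n ^_ t)%N -> forall i : nat, (1 <= i <= n - t)%N -> freq D i = 0%R).
Proof.
case: (leqP t n) => [tn|nt]; last first.
  (* For [t > n] the bound is 0, and the truncated [n - t] is 0, which leaves no index [i]. *)
  rewrite ffact_small //; split=> // _ i.
  by rewrite (eqP (ltnW nt : (n - t == 0)%N)); case: i.
have Dgt0 : (0 < #|D|)%N by rewrite lt0n cards_eq0.
have nfix1 : nfix (1 : 'S_n)%g = n.
  by rewrite -[RHS]card_ord; apply: eq_card => x; rewrite !inE perm1 eqxx.
have := design_sum_ffact tn hD0 hD.
rewrite (bigID (fun p => p.1 == p.2)) /=.
set diag := (X in (X + _)%N); set rest := (X in (_ + X)%N).
have -> : diag = (#|D| * n ^_ t)%N.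
  rewrite /diag (eq_bigr (fun=> (n ^_ t)%N)); last first.
    by move=> p /andP[_ /eqP->]; rewrite mulgV nfix1.
  rewrite sum_nat_const; congr (_ * _)%N.
  rewrite -(card_imset D (f := fun x => (x, x))); last by move=> x y [].
  apply: eq_card => -[x y]; rewrite unfold_in in_setX /=.
  apply/andP/imsetP => [[/andP[xD _] /eqP <-]|[z zD [-> ->]]]; first by exists x.
  by rewrite zD.
rewrite -mulnn => sumE; split.
  by rewrite -(leq_pmul2l Dgt0) -sumE leq_addr.
move=> Dn i /andP[i0 it].
(* The diagonal alone now accounts for the full [#|D| * #|D|], so each off-diagonal term is zero. *)
move: sumE; rewrite -Dn -[RHS]addn0 => /addnI/eqP.
rewrite sum_nat_eq0 => /forallP rest0.
rewrite /freq (_ : [set _ in _ | _] = set0) ?cards0 ?mul0r //.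
apply/setP => -[x y]; rewrite in_set0 inE /=; apply/negP => /andP[xyD /eqP dxy].
move/implyP: (rest0 (x, y)) => /=; rewrite xyD /= -leqn0 leqNgt ffact_gt0.
have [xy _|xy] := eqVneq x y.
  by move: i0; rewrite -dxy /dS xy mulgV nfix1 subnn.
(* A distance of at most [n - t] would give at least [t] fixed points, hence a nonzero term;
   comparing the truncated differences relies on [t <= n]. *)
move=> /(_ isT)/negP; apply; move: it; rewrite -dxy /dS.
by rewrite leq_sub2lE.
Qed.
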